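(* Let $\lambda$ be a regular uncountable cardinal, $p$ a prime, $\overline C=\langle c_\delta:\delta\in S\rangle$ a club guessing sequence on $\lambda$, and for each $\delta\in S$ let $A_\delta\subseteq c_\delta$ be a set of order type $\omega$. Then there is a separable $p$-group $G$ of cardinality $\lambda$ and a $\lambda$-filtration $\overline G$ of $G$ such that $A_\delta\in P_\delta(\overline G,\overline C)$ for every $\delta\in S$.
   Context: Groups are abelian. A separable $p$-group is an abelian $p$-group with no nonzero elements of infinite height. A club guessing sequence on $\lambda$ is $\overline C=\langle c_\delta:\delta\in S\rangle$ with $S\subseteq\lambda$ stationary, $c_\delta\subseteq\delta$, $\sup c_\delta=\delta$, such that for every closed unbounded $E\subseteq\lambda$ the set $\{\delta\in S:c_\delta\subseteq E\}$ is stationary. A $\lambda$-filtration of $G$ ($|G|=\lambda$) is a sequence $\langle G_\alpha:\alpha<\lambda\rangle$ of subgroups with $G_\alpha\subseteq G_{\alpha+1}$, $|G_\alpha|<\lambda$, $G_\alpha=\bigcup_{\beta<\alpha}G_\beta$ for limit $\alpha$, $G=\bigcup_\alpha G_\alpha$. For $m\ge1$, $mG=\{mg:g\in G\}$. For $\delta\in S$ with increasing enumeration $\langle\alpha_i:i<i^*\rangle$ of $c_\delta$ and $g\in G$, $\mathrm{Inv}_{\overline G}(g,c_\delta)=\{\alpha_i:i<i^*,\ \exists m\ge1,\ g\in(G_{\alpha_{i+1}}+mG)\setminus(G_{\alpha_i}+mG)\}$, and $P_\delta(\overline G,\overline C)=\{\mathrm{Inv}_{\overline G}(g,c_\delta):g\in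 G\}$. *)

(* Defs.v *)
From mathcomp Require Import all_boot all_order all_algebra.
From mathcomp Require Import boolp classical_sets functions cardinality wochoice.

Set Implicit Arguments.
Unset Strict Implicit.
Unset Printing Implicit Defensive.

Import Order.TTheory GRing.Theory.

Local Open Scope classical_set_scope.
Local Open Scope card_scope.

(* The cardinal lambda is represented by a totally ordered type L, whose
   elements are the ordinals below lambda; the ordinal a is identified with
   its initial segment [below a], and subsets of lambda are sets over L. *)

Definition card_lt T U (A : set T) (B : set U) : bool :=
  (A #<= B) && ~~ (B #<= A).

Section Ordinals.
Variables (disp : Order.disp_t) (L : orderType disp).
Implicit Types (a b d : L) (E S X : set L) (c : L -> set L).
Local Open Scope order_scope.

Definition below a : set L := [set b | b < a].

Definition next_in X a b : Prop :=
  [/\ X b, a < b & forall e, X e -> a < e -> b <= e].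

Definition ord_succ a b : Prop := next_in [set: L] a b.

Definition ord_limit a : Prop := below a !=set0 /\ ~ exists b, ord_succ b a.

Definition cofinal X : Prop := forall a, exists2 x, X x & a <= x.

(* L is (order isomorphic to) a regular uncountable cardinal: a well-order, no
   initial segment of which is equipotent with L, with cofinality |L|. *)
Definition regular_uncountable_cardinal : Prop :=
  [/\ well_order (<=%O : rel L),
      forall a, card_lt (below a) [set: L],
      ~ countable [set: L]
    & forall X, cofinal X -> ~~ card_lt X [set: L]].

(* [supremums X d] says that d is the least upper bound of X. *)
Definition club E : Prop :=
  cofinal E /\ forall d, ord_limit d -> supremums (E `&` below d) d -> E d.

Definition stationary S : Prop := forall E, club E -> S `&` E !=set0.

(* The values of c outside S are irrelevant. *)
Definition club_guessing S c : Prop :=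
  [/\ stationary S,
      forall d, S d -> c d `<=` below d,
      forall d, S d -> supremums (c d) d
    & forall E, club E -> stationary [set d | S d /\ c d `<=` E]].

Definition order_type_omega X : Prop :=
  exists2 f : nat -> L, {mono f : m n / (m <= n)%N >-> m <= n} & range f = X.

End Ordinals.

Section Groups.
Local Open Scope ring_scope.

Definition abelian_pgroup (p : nat) (G : zmodType) : Prop :=
  forall x : G, exists n, x *+ (p ^ n)%N = 0.

Definition infinite_height (p : nat) (G : zmodType) (x : G) : Prop :=
  forall n, exists y : G, x = y *+ (p ^ n)%N.

Definition separable_pgroup (p : nat) (G : zmodType) : Prop :=
  abelian_pgroup p G /\ forall x : G, infinite_height p x -> x = 0.

Definition multiples (m : nat) (G : zmodType) : set G :=
  range (fun g : G => g *+ m).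
Arguments multiples : clear implicits.

Definition set_add (G : zmodType) (H K : set G) : set G :=
  [set x + y | x in H & y in K].

Variables (disp : Order.disp_t) (L : orderType disp) (G : zmodType).
Implicit Types (Gs : L -> set G) (c : L -> set L).

Definition filtration Gs : Prop :=
  [/\ forall a, zmod_closed [in Gs a],
      forall a b, ord_succ a b -> Gs a `<=` Gs b,
      forall a, card_lt (Gs a) [set: L],
      forall a, ord_limit a -> Gs a = \bigcup_(b in below a) Gs b
    & \bigcup_a Gs a = [set: G]].

(* With a = alpha_i in the increasing enumeration of X, the element
   alpha_(i+1) is the least element of X above a. *)
Definition inv_set Gs (g : G) (X : set L) : set L :=
  [set a | X a /\ exists2 b, next_in X a b & exists2 m, (1 <= m)%N &
     (set_add (Gs b) (multiples m G) `\` set_add (Gs a) (multiples m G)) g].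

Definition inv_sets Gs c (d : L) : set (set L) :=
  [set inv_set Gs g (c d) | g in [set: G]].

End Groups.

(* Main.v *)
(* Let f_d enumerate A_d.  In the product of the groups Z/p^(n+1) over the pairs
   (a, n), with unit vectors e_(a,n), put y_(d,k) = sum_(n >= k) p^(n-k) e_(f_d n, n).
   The group G is generated by all e_(a,n) and y_(d,k), and G_a by those whose
   first index is below a.  Modulo p^k G, the element y_(d,0) agrees with the
   finite sum of the p^j e_(f_d j, j) for j < k, and reading the coordinate
   (f_d j, j) shows that y_(d,0) lies in G_a + p^k G exactly when f_d j < a for
   all j < k.  Hence Inv(y_(d,0), c_d) = A_d.  For the cardinalities, regularity
   gives that fewer than lambda sets of size less than lambda have a union of
   size less than lambda, so no cardinal arithmetic is needed. *)
Require Import Defs.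
From HB Require Import structures.
From mathcomp Require Import all_boot all_order all_algebra.
From mathcomp Require Import boolp classical_sets functions cardinality wochoice.

Set Implicit Arguments.
Unset Strict Implicit.
Unset Printing Implicit Defensive.

Import Order.TTheory GRing.Theory.

Local Open Scope classical_set_scope.
Local Open Scope card_scope.

(** * Injections and minimal elements *)

Lemma card_leT_inj T U (X : set U) : [set: T] #<= X ->
  exists2 h : T -> U, injective h & forall x, X (h x).
Proof.
move=> /card_leP[f]; exists (fun x => val (f (SigSub (mem_set (I : [set: T] x))))).
  by move=> x y /val_inj /inj -/(_ (mem_set I) (mem_set I))/(congr1 val).
by move=> x; apply: set_valP.
Qed.

Lemma inj_card_leT T U (X : set U) (h : T -> U) :
  injective h -> (forall x, X (h x)) -> [set: T] #<= X.
Proof.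
move=> hI hX; apply: (card_le_trans _ (subset_card_le (_ : range h `<=` X))).
  have /inj_card_eq : {in [set: T] &, injective h} by apply: in2W.
  by rewrite card_eq_le => /andP[].
by move=> _ [x _ <-].
Qed.

Lemma well_founded_minimal T (R : T -> T -> Prop) :
  (forall P : set T, P !=set0 -> exists2 z, P z & forall x, P x -> ~ R x z) ->
  well_founded R.
Proof.
move=> minR x; apply: contrapT => nAx.
have [z nAz minz] := minR (fun x => ~ Acc R x) (ex_intro _ x nAx).
by apply: nAz; constructor => y Ryz; apply: contrapT => /minz; apply.
Qed.

Lemma well_order_minimal T (R : rel T) (P : set T) : well_order R -> P !=set0 ->
  exists2 z, P z & forall x, P x -> R z x.
Proof.
move=> wR [x Px]; have [|z [[/asboolP Pz minz] _]] := wR [pred x | `[< P x >]].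
  by exists x; apply/asboolP.
by exists z => // y Py; apply: minz; apply/asboolP.
Qed.

(** * Sets of cardinality less than lambda *)

Section Small.
Variables (disp : Order.disp_t) (L : orderType disp).
Hypothesis hL : regular_uncountable_cardinal L.

(** Only the negative half of [card_lt] is kept, so smallness passes down along [#<=] by
    transitivity alone. *)
Definition small T (X : set T) : Prop := ~~ ([set: L] #<= X).

Lemma card_le_small T U (X : set T) (Y : set U) : X #<= Y -> small Y -> small X.
Proof. by move=> XY; apply: contraNN => /card_le_trans; apply. Qed.

Lemma small_below (a : L) : small (below a).
Proof. by have [_ /(_ a)/andP[_]] := hL. Qed.

Lemma countable_small T (X : set T) : countable X -> small X.
Proof.
have [_ _ ncL _] := hL => cX; apply/negP => LX; apply: ncL.
exact: sub_countable LX cX.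
Qed.

(** Regularity, contraposed: a set with no strict upper bound is cofinal, and a subset of [L] always
    satisfies the first half of [card_lt]. *)
Lemma small_bounded (X : set L) : small X -> exists a, forall x, X x -> (x < a)%O.
Proof.
have [_ _ _ reg] := hL => sX; apply: contrapT => nb.
have /reg : cofinal X.
  move=> a; apply: contrapT => na; apply: nb; exists a => x Xx.
  by rewrite ltNge; apply/negP => ax; apply: na; exists x.
by rewrite /card_lt sX card_leT.
Qed.

(* Otherwise L would be a union of few bounded sets, hence bounded. *)
Lemma small_bigcup I T (D : set I) (F : I -> set T) :
  small D -> (forall i, D i -> small (F i)) -> small (\bigcup_(i in D) F i).
Proof.
move=> sD sF; apply/negP => /card_leT_inj[h hI hF].
have /choice[r hr] : forall x, exists i, D i /\ F i (h x).
  by move=> x; have [i Di Fi] := hF x; exists i.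
have /choice[s hs] : forall i, exists a, forall x, r x = i -> (x < a)%O.
  move=> i; apply: small_bounded; have [Di|nDi] := pselect (D i).
    apply: card_le_small (sF i Di); apply: (card_le_trans (B := h @` [set x | r x = i])).
      have /inj_card_eq : {in [set x | r x = i] &, injective h} by apply: in2W.
      by rewrite card_eq_le => /andP[].
    by apply: subset_card_le => _ [x <- <-]; have [] := hr x.
  apply: card_le_small (countable_small (@countable0 L)); apply: subset_card_le => x ri.
  by case: nDi; rewrite -ri; have [] := hr x.
have [g hg] : exists a, forall x, (s @` D) x -> (x < a)%O.
  by apply: small_bounded; apply: card_le_small sD; apply: card_image_le.
(* The bound [g] is itself an element of [L]: it lies below [s (r g)], which lies below [g]. *)
have Dr : D (r g) by have [] := hr g.
have := lt_trans (hs _ g erefl) (hg _ (imageP s Dr)).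
by rewrite ltxx.
Qed.

Lemma small_setU T (X Y : set T) : small X -> small Y -> small (X `|` Y).
Proof.
move=> sX sY; rewrite -bigcup2E; apply: small_bigcup.
  exact: countable_small.
by move=> [|[|n]] _ //=; apply: countable_small.
Qed.

Lemma small_image2 T U V (f : T -> U -> V) (X : set T) (Y : set U) :
  small X -> small Y -> small [set f x y | x in X & y in Y].
Proof.
move=> sX sY; apply: (card_le_small (Y := \bigcup_(x in X) f x @` Y)).
  by apply: subset_card_le => _ [x Xx [y Yy <-]]; exists x => //; exists y.
apply: small_bigcup => // x _; apply: card_le_small sY; apply: card_image_le.
Qed.

(* Well-order T by (rank, R), where R is any well-order of T: every initial
   segment is small, so an injection into L can be built by recursion. *)
Lemma card_le_bigcup_small T (F : L -> set T) :
  (forall a, small (F a)) -> {homo F : a b / (a <= b)%O >-> a `<=` b} ->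
  \bigcup_a F a = [set: T] -> [set: T] #<= [set: L].
Proof.
move=> sF monoF FT; have [woL _ _ _] := hL.
have /choice[r hr] : forall x, exists a, F a x /\ forall b, F b x -> (a <= b)%O.
  move=> x; have [|a] := well_order_minimal (P := [set a | F a x]) woL.
    by have [a _ Fa] : (\bigcup_a F a) x by [rewrite FT]; exists a.
  by exists a.
have [R woR] := well_ordering_principle {classic T}.
pose lt (x y : T) := (r x < r y)%O \/ [/\ r x = r y, x <> y & R x y].
have anti x y : R x y -> R y x -> x = y.
  move=> Rxy Ryx.
  by apply: (wo_chain_antisymmetric (withinW (A := predT) woR)) => //; rewrite Rxy.
have wf : well_founded lt.
  apply: well_founded_minimal => P [x0 Px0].
  have [|a [x Px <-] mina] := well_order_minimal (P := r @` P) woL.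
    by exists (r x0), x0.
  have [|z [Pz rz] minz] := well_order_minimal (P := P `&` [set z | r z = r x]) woR.
    by exists x.
  exists z => // y Py [|[ryz yz Ryz]].
    by rewrite ltNge rz => /negP; apply; apply: mina; exists y.
  by apply: yz; apply: anti => //; apply: minz; split=> //=; rewrite ryz.
(* Were every value taken, choosing an argument for each would inject [L] into the predecessors of
   [x], all of which lie in the small set [F (r x)]. *)
have fresh (x : T) (g : forall y, lt y x -> L) :
    exists a, forall y (yx : lt y x), g y yx <> a.
  apply: contrapT => no.
  have full a : exists y (yx : lt y x), g y yx = a.
    apply: contrapT => na; apply: no; exists a => y yx gy.
    by apply: na; exists y, yx.
  have /choice[k hk] : forall a, exists y, exists yx : lt y x, g y yx = a by [].
  have := sF (r x); apply/negP; rewrite negbK; apply: (inj_card_leT (h := k)).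
    move=> a b kab; have [ya <-] := hk a; have [yb <-] := hk b.
    by move: ya yb; rewrite kab => ya yb; rewrite (Prop_irrelevance ya yb).
  move=> a; have [yx _] := hk a; apply: (monoF (r (k a))); last by have [] := hr (k a).
  by case: yx => [/ltW|[->]].
have pick x g := cid (fresh x g).
(* [f x] avoids the values at all earlier points; since [lt] compares any two distinct points, [f]
   is injective. *)
pose f := Fix wf (fun=> L) (fun x g => sval (pick x g)).
have fE x : f x = sval (pick x (fun y _ => f y)).
  rewrite /f Fix_eq // => {}x g h gh; congr (sval (pick x _)).
  by apply: functional_extensionality_dep => y; apply: funext => yx; apply: gh.
have flt x y : lt y x -> f y <> f x.
  by move=> yx; rewrite [f x]fE; exact: (svalP (pick x _) y yx).
apply: (inj_card_leT (h := f)) => // x y fxy; apply: contrapT => xy.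
have [rxy|rxy|rxy] := ltgtP (r x) (r y).
- by apply: (flt y x) => //; left.
- by apply: (flt x y) => //; left.
- have /orP[Rxy|Ryx] := wo_chainW (withinW (A := predT) woR) (x := x) (y := y) isT isT.
    by apply: (flt y x) => //; right.
  by apply: (flt x y) => //; right; split=> // /esym.
Qed.

End Small.

Local Open Scope ring_scope.

(** * Subgroups generated by a set *)

Section Span.
Variable M : zmodType.
Implicit Types X H : set M.

(** Subtraction alone yields a subgroup once 0 is adjoined. Each stage is an image of pairs from the
    previous one, so smallness propagates through the countably many stages. *)
Fixpoint diffs X n : set M :=
  if n is n'.+1 then [set x - y | x in diffs X n' & y in diffs X n']
  else X `|` [set 0].

Definition span X : set M := \bigcup_n diffs X n.

Lemma diffs0 X n : diffs X n 0.
Proof. by elim: n => [|n IHn]; [right|exists 0 => //; exists 0; rewrite ?subr0]. Qed.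

Lemma diffs_leq X m n : (m <= n)%N -> diffs X m `<=` diffs X n.
Proof.
move=> /subnK<-; elim: (n - m)%N => // k IHk x /IHk xX.
by exists x => //; exists 0; [exact: diffs0|rewrite subr0].
Qed.

Lemma span_sub X : X `<=` span X.
Proof. by move=> x Xx; exists 0%N => //; left. Qed.

Lemma span0 X : span X 0.
Proof. by exists 0%N => //; right. Qed.

Lemma spanB X x y : span X x -> span X y -> span X (x - y).
Proof.
move=> [m _ mx] [n _ ny]; exists (maxn m n).+1 => //.
exists x; first exact: diffs_leq (leq_maxl _ _) _ mx.
by exists y => //; apply: diffs_leq (leq_maxr _ _) _ ny.
Qed.

(** Serves as the induction principle for [span]; [H] will be torsion, vanishing of a coordinate, or
    membership in an earlier subgroup. *)
Lemma span_min X H : H 0 -> (forall x y, H x -> H y -> H (x - y)) ->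
  X `<=` H -> span X `<=` H.
Proof.
move=> H0 HB XH x [n _]; elim: n x => [x [/XH//|->//]|n IHn].
by move=> _ [x /IHn Hx [y /IHn Hy <-]]; apply: HB.
Qed.

Lemma span_mono X H : X `<=` H -> span X `<=` span H.
Proof.
move=> XH; apply: span_min => [|x y|x /XH]; [exact: span0|exact: spanB|exact: span_sub].
Qed.

Lemma span_zmod_closed X : zmod_closed [in span X].
Proof.
split=> [|x y]; rewrite !unfold_in => *; apply/mem_set; first exact: span0.
by apply: spanB; exact: set_mem.
Qed.

Definition span_pred X : {pred M} := [in span X].
HB.instance Definition _ X :=
  GRing.isZmodClosed.Build M (span_pred X) (span_zmod_closed X).

Definition spanned X : Type := {x : M | x \in span_pred X}.
HB.instance Definition _ X := SubChoice.on (spanned X).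
HB.instance Definition _ X := [SubChoice_isSubZmodule of spanned X by <:].

Lemma small_span disp (L : orderType disp) X :
  regular_uncountable_cardinal L -> small L X -> small L (span X).
Proof.
move=> hL sX; apply: small_bigcup => // [|n _]; first exact: countable_small.
elim: n => [|n IHn]; last exact: small_image2.
by apply: small_setU => //; apply: countable_small.
Qed.

End Span.

(** * Products of families of abelian groups *)

Section DependentProduct.
Variables (I : Type) (T : I -> zmodType).

Definition dprod : Type := forall i, T i.

HB.instance Definition _ := gen_eqMixin dprod.
HB.instance Definition _ := gen_choiceMixin dprod.

Let zero : dprod := fun=> 0.
Let opp (f : dprod) : dprod := fun i => - f i.
Let add (f g : dprod) : dprod := fun i => f i + g i.

Let addA : associative add.
Proof. by move=> f g h; apply: functional_extensionality_dep => i; apply: addrA. Qed.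
Let addC : commutative add.
Proof. by move=> f g; apply: functional_extensionality_dep => i; apply: addrC. Qed.
Let add0 : left_id zero add.
Proof. by move=> f; apply: functional_extensionality_dep => i; apply: add0r. Qed.
Let addN : left_inverse zero opp add.
Proof. by move=> f; apply: functional_extensionality_dep => i; apply: addNr. Qed.

HB.instance Definition _ := GRing.isZmodule.Build dprod addA addC add0 addN.

Lemma dprodBE (f g : dprod) i : (f - g) i = f i - g i.
Proof. by []. Qed.

Lemma dprodMnE (f : dprod) n i : (f *+ n) i = f i *+ n.
Proof. by elim: n => // n IHn; rewrite !mulrS -IHn. Qed.

End DependentProduct.

Lemma next_in_le disp (L : orderType disp) (X : set L) a b x :
  next_in X a b -> X x -> (x < b)%O -> (x <= a)%O.
Proof.
by move=> [_ _ minb] Xx xb; rewrite leNgt; apply/negP => /(minb x Xx); rewrite leNgt xb.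
Qed.

Lemma mulrn_modn (V : zmodType) (x : V) q m n :
  x *+ q = 0 -> m = n %[mod q] -> x *+ m = x *+ n.
Proof.
have red k : x *+ q = 0 -> x *+ k = x *+ (k %% q).
  by move=> xq; rewrite {1}(divn_eq k q) mulrnDr mulnC mulrnA xq mul0rn add0r.
by move=> xq mn; rewrite red // mn -red.
Qed.

(** * The group, its filtration and the invariants of the witnesses *)

Section Construction.
Variables (disp : Order.disp_t) (L : orderType disp) (p : nat).
Hypothesis hp : prime p.
Variable f : L -> nat -> L.

Definition ambient := dprod (fun i : L * nat => 'Z_(p ^ i.2.+1)%N).

Definition unit_vec (a : L) n : ambient := fun i => (i == (a, n))%:R.

(* The formal series sum_(n >= k) p^(n-k) e_(f d n, n); the condition on [i.1]
   is vacuous when [f d] takes values below [d]. *)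
Definition tail_vec (d : L) k : ambient := fun i =>
  if [&& (k <= i.2)%N, i.1 == f d i.2 & (i.1 < d)%O] then (p ^ (i.2 - k))%:R else 0.

Definition gens_at b : set ambient := range (unit_vec b) `|` range (tail_vec b).
Definition gens_below a : set ambient := \bigcup_(b in below a) gens_at b.
Definition gens : set ambient := \bigcup_b gens_at b.
Definition group : zmodType := spanned gens.
Definition filt a : set group := [set x | span (gens_below a) (val x)].

(** ['Z_q] is the ring of integers modulo [q] only when [q > 1]. *)
Lemma pexp_gt1 n : (1 < p ^ n.+1)%N.
Proof. by rewrite -(exp1n n.+1) ltn_exp2r // prime_gt1. Qed.

Lemma Zp_mulrn_eq0 n m (x : 'Z_(p ^ n.+1)) : (p ^ n.+1 %| m)%N -> x *+ m = 0.
Proof.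
by move=> /dvdnP[k ->]; rewrite mulrnA -mulr_natr pchar_Zp ?pexp_gt1 // mulr0.
Qed.

(** Sufficiently divisible multiples are invisible at a given coordinate: this gives separability,
    and later lets one coordinate detect non-membership. *)
Lemma ambient_mulrn_eq0 (x : ambient) i m : (p ^ i.2.+1 %| m)%N -> (x *+ m) i = 0.
Proof. by rewrite dprodMnE; apply: Zp_mulrn_eq0. Qed.

Lemma unit_vec_torsion a n : unit_vec a n *+ p ^ n.+1 = 0.
Proof.
apply: functional_extensionality_dep => i; rewrite dprodMnE /unit_vec.
by case: eqP => [->|_]; rewrite ?mul0rn // Zp_mulrn_eq0.
Qed.

(** One exponent serves all coordinates: at level [n >= k] the entry [p^(n-k)] times [p^(k+1)] is
    [p^(n+1)]. *)
Lemma tail_vec_torsion d k : tail_vec d k *+ p ^ k.+1 = 0.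
Proof.
apply: functional_extensionality_dep => i; rewrite dprodMnE /tail_vec.
case: ifP => [/andP[ki _]|_]; rewrite ?mul0rn //.
by rewrite -mulrnA -expnD addnS subnK // pchar_Zp ?pexp_gt1.
Qed.

Lemma span_torsion x : span gens x -> exists n, x *+ p ^ n = 0.
Proof.
move: x; apply: span_min => [|x y [m xm] [n yn]|x [b _ [|] [n _ <-]]].
- by exists 0%N; rewrite mul0rn.
- exists (m + n)%N; rewrite mulrnBl expnD mulrnA xm mul0rn mulnC mulrnA yn.
  by rewrite mul0rn subr0.
- by exists n.+1; apply: unit_vec_torsion.
- by exists n.+1; apply: tail_vec_torsion.
Qed.

(** For tail vectors, the guard [i.1 < d] in [tail_vec] makes this hold whatever the values of
    [f]. *)
Lemma span_support a x i : span (gens_below a) x -> (a <= i.1)%O -> x i = 0.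
Proof.
move=> xa ai; move: x xa; apply: span_min => [//|x y x0 y0|x [b ba [|] [n _ <-]]].
- by rewrite dprodBE x0 y0 subr0.
- rewrite /unit_vec; case: eqP => // ib; move: ba; rewrite /below /=.
  by rewrite ltNge -[b]/(b, n).1 -ib ai.
- rewrite /tail_vec; case: ifP => // /and3P[_ _ ib].
  by have := lt_trans (le_lt_trans ai ib) ba; rewrite ltxx.
Qed.

(** The leading term is split off and the remaining exponents drop by one, whence the factor [p].
    The hypothesis meets the guard at the leading coordinate. *)
Lemma tail_vecS d k : (f d k < d)%O ->
  tail_vec d k = unit_vec (f d k) k + tail_vec d k.+1 *+ p.
Proof.
move=> fd; apply: functional_extensionality_dep => -[a n].
rewrite -[RHS]/(unit_vec (f d k) k (a, n) + (tail_vec d k.+1 *+ p) (a, n)).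
rewrite dprodMnE /tail_vec /unit_vec /= xpair_eqE.
have [nk|nk|->] := ltngtP n k.
- by rewrite andbF mul0rn addr0.
- rewrite andbF add0r; case: ifP => _; rewrite ?mul0rn //.
  by rewrite -mulrnA -expnSr subnSK.
- rewrite subnn mul0rn addr0 andbT; case: eqP => [->|]//=.
  by rewrite fd.
Qed.

Lemma gens_below_sub a : gens_below a `<=` gens.
Proof. by move=> x [b _ xb]; exists b. Qed.

Lemma gens_below_le a b : (a <= b)%O -> gens_below a `<=` gens_below b.
Proof. by move=> ab x [e ea xe]; exists e => //; apply: lt_le_trans ea ab. Qed.

Lemma filt_le a b : (a <= b)%O -> filt a `<=` filt b.
Proof. by move=> ab x; apply: span_mono; apply: gens_below_le. Qed.

Lemma filt_zmod_closed a : zmod_closed [in filt a].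
Proof.
split=> [|x y]; rewrite !unfold_in => *; apply/mem_set.
  by change (span (gens_below a) (val (0 : group))); rewrite raddf0; apply: span0.
change (span (gens_below a) (val (x - y))).
by rewrite raddfB; apply: spanB; exact: set_mem.
Qed.

Definition witness d : group :=
  Sub (tail_vec d 0) (mem_set (span_sub (ex_intro2 _ _ d I (or_intror (imageP _ I))))).

Lemma witnessE d : val (witness d) = tail_vec d 0. Proof. exact: SubK. Qed.

(** Only the [p]-part of [m] matters: the cofactor [u] is prime to [p], hence invertible on an
    element killed by [p^(k+1)]. *)
Lemma tail_vec_div d k m : (0 < m)%N -> logn p m = k ->
  exists n, tail_vec d k *+ p ^ k = tail_vec d k *+ n *+ m.
Proof.
move=> m_gt0 mk; have [u pu mE] := pfactor_coprime hp m_gt0.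
have cu : coprime u (p ^ k.+1) by rewrite coprime_sym coprimeXl.
(* [w] is 0 modulo [u] and 1 modulo [p^(k+1)], so [w %/ u] acts as an inverse of [u]. *)
pose w := chinese u (p ^ k.+1) 0 1.
have uw : (u %| w)%N by rewrite /dvdn chinese_modl // mod0n.
exists (w %/ u)%N; rewrite mE mk -mulrnA mulnA divnK // mulrnA; congr (_ *+ _).
rewrite -[LHS]mulr1n; apply: mulrn_modn (tail_vec_torsion d k) _.
by rewrite chinese_modr.
Qed.

(** Iterating [tail_vecS], [h] is the sum of the [p^j e_(f d j, j)] for [j < k]. *)
Lemma witness_decomp d a k : (forall n, f d n < d)%O ->
  (forall j, (j < k)%N -> f d j < a)%O ->
  exists2 h, span (gens_below a) h & tail_vec d 0 = h + tail_vec d k *+ p ^ k.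
Proof.
move=> fd; elim: k => [|k IHk] fa; first by exists 0; [exact: span0|rewrite add0r].
have [j jk|h ha hE] := IHk; first by apply: fa; apply: leqW.
exists (h + unit_vec (f d k) k *+ p ^ k).
  have uk : span (gens_below a) (unit_vec (f d k) k).
    by apply: span_sub; exists (f d k); [exact: fa|left; exists k].
  apply: (set_mem (_ : _ \in span_pred (gens_below a))).
  by rewrite rpredD ?rpredMn //; apply: mem_set.
by rewrite {1}hE (tail_vecS (fd k)) mulrnDl addrA -mulrnA expnS.
Qed.

Lemma witnessP d a m : (forall n, f d n < d)%O -> (0 < m)%N ->
  set_add (filt a) (@multiples m group) (witness d) <->
  forall j, (j < logn p m)%N -> (f d j < a)%O.
Proof.
move=> fd m_gt0; split=> [[x xa [_ [z _ <-] /(congr1 val)]]|fa].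
  rewrite witnessE raddfD raddfMn => E j jm; rewrite ltNge; apply/negP => af.
  (* At this coordinate [x] vanishes by its support and the multiple of [m] because [p^(j+1)]
     divides [m], whereas the witness has entry [p^j], nonzero modulo [p^(j+1)]. *)
  have := congr1 (fun g : ambient => g (f d j, j)) (esym E).
  rewrite -[RHS]/(val x (f d j, j) + (val z *+ m) (f d j, j)) (span_support xa) //.
  rewrite ambient_mulrn_eq0 ?pfactor_dvdn // addr0 /tail_vec /= eqxx fd subn0.
  move=> /(congr1 (@nat_of_ord _)); rewrite val_Zp_nat ?pexp_gt1 //= modn_small.
    by move/eqP; rewrite expn_eq0 (gtn_eqF (prime_gt0 hp)).
  by rewrite ltn_exp2l ?prime_gt1.
have [h ha hE] := witness_decomp fd fa.
have [n nE] := tail_vec_div d m_gt0 erefl.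
have hG : h \in span_pred gens.
  by apply/mem_set; apply: span_mono ha; apply: gens_below_sub.
have tG : tail_vec d (logn p m) \in span_pred gens.
  by apply/mem_set; apply: span_sub; exists d => //; right; exists (logn p m).
pose h' : group := Sub h hG; pose t' : group := Sub (tail_vec d (logn p m)) tG.
exists h'; first exact: ha.
exists (t' *+ n *+ m); first by exists (t' *+ n).
by apply: val_inj; rewrite raddfD !raddfMn witnessE hE nE.
Qed.

Lemma group_separable : separable_pgroup p group.
Proof.
split=> [x|x hx].
  have [n xn] := span_torsion (set_mem (valP x)).
  by exists n; apply: val_inj; rewrite raddfMn raddf0.
apply: val_inj; rewrite raddf0; apply: functional_extensionality_dep => i.
by have [y ->] := hx i.2.+1; rewrite raddfMn ambient_mulrn_eq0.
Qed.

Lemma unit_vec_inj n : injective (unit_vec^~ n).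
Proof.
move=> a b /(congr1 (fun g : ambient => g (a, n))); rewrite /unit_vec eqxx xpair_eqE eqxx.
by case: eqP => //= _ /eqP; rewrite oner_eq0.
Qed.

Lemma card_le_group : [set: L] #<= [set: group].
Proof.
have uG a : unit_vec a 0 \in span_pred gens.
  by apply/mem_set/span_sub; exists a => //; left; exists 0%N.
pose h a : group := Sub (unit_vec a 0) (uG a).
apply: (inj_card_leT (h := h)) => // a b /(congr1 val) ab.
exact: (@unit_vec_inj 0).
Qed.

Lemma inv_setP d (X : set L) : well_order (<=%O : rel L) ->
  (forall n, f d n < d)%O -> {mono f d : m n / (m <= n)%N >-> (m <= n)%O} ->
  (forall n, X (f d n)) -> inv_set filt (witness d) X = range (f d).
Proof.
move=> woL fd fmono fX; apply/seteqP; split=> [a [Xa [b ab [m m_gt0 []]]]|_ [n _ <-]].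
  move=> /(witnessP _ fd m_gt0) fb /(witnessP _ fd m_gt0) fa.
  (* Every [f d j] below [b] is at most [a], as [b] follows [a] in [X]; if none equals [a], all are
     below [a], contradicting [fa]. *)
  apply: contrapT => na; apply: fa => j /fb fjb.
  rewrite lt_neqAle (next_in_le ab (fX j) fjb) andbT.
  by apply/eqP => fja; apply: na; exists j.
have flt i j : (i < j)%N -> (f d i < f d j)%O by rewrite !ltNge fmono -ltnNge.
(* [f d n] has a successor in [X], since [f d n.+1] is a larger element of [X]. *)
split=> //; have [|b [Xb nb] minb] := well_order_minimal
    (P := X `&` [set b | (f d n < b)%O]) woL.
  by exists (f d n.+1); split; [exact: fX|exact: flt].
exists b; first by split=> // e Xe ne; apply: minb.
(* With exponent [n.+1] the indices [j <= n] are tested: all pass at [b] by monotonicity, and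
   [j = n] fails at [f d n]. *)
have pn_gt0 : (0 < p ^ n.+1)%N by rewrite expn_gt0 prime_gt0.
exists (p ^ n.+1)%N => //.
split.
  apply/(witnessP _ fd pn_gt0) => j; rewrite pfactorK // ltnS -fmono.
  by move=> /le_lt_trans; apply.
by move=> /(witnessP _ fd pn_gt0)/(_ n); rewrite pfactorK // ltxx => /(_ (leqnn _)).
Qed.

(** * Cardinalities and the filtration axioms *)

Hypothesis hL : regular_uncountable_cardinal L.

(** Fewer than lambda indices lie below [a], and each contributes countably many generators. *)
Lemma filt_small a : small L (filt a).
Proof.
apply: (card_le_small (Y := span (gens_below a))).
  have /inj_card_eq : {in filt a &, injective (val : group -> ambient)}.
    exact: in2W val_inj.
  rewrite card_eq_le => /andP[_ /card_le_trans]; apply.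
  by apply: subset_card_le => _ [x ax <-].
apply: small_span => //; apply: small_bigcup => // [|b _]; first exact: small_below.
apply: small_setU => //; apply: countable_small => //;
  exact: sub_countable (card_image_le _ _) (countableP _).
Qed.

Lemma filt_limit a : ord_limit a -> filt a = \bigcup_(b in below a) filt b.
Proof.
move=> [[b0 ab0] nsucc]; apply/seteqP; split; last first.
  by move=> x [b ba]; apply: filt_le; apply: ltW.
suff H x : span (gens_below a) x -> exists2 b, below a b & span (gens_below b) x.
  by move=> x /H[b ba bx]; exists b.
move: x; apply: span_min => [|x y [b ba bx] [e ea ey]|x [b ba bx]].
- by exists b0 => //; exact: span0.
- exists (Order.max b e); first by rewrite /below /= gt_max ba ea.
  apply: spanB.
    by apply: span_mono bx; apply: gens_below_le; rewrite le_max lexx.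
  by apply: span_mono ey; apply: gens_below_le; rewrite le_max lexx orbT.
(* A generator of index [b] enters at any [e] above [b]; without such an [e] below [a], [a] would be
   the successor of [b]. *)
- have [[e [be ea]]|no] := pselect (exists e, (b < e)%O /\ (e < a)%O).
    by exists e => //; apply: span_sub; exists b.
  case: nsucc; exists b; split=> // e _ be; rewrite leNgt; apply/negP => ea.
  by apply: no; exists e.
Qed.

Lemma filt_cover : \bigcup_a filt a = [set: group].
Proof.
(* Singletons are strictly bounded, so [L] has no last element. *)
have above (b : L) : exists e, (b < e)%O.
  have [|e he] := small_bounded hL (X := [set b]); last by exists e; apply: he.
  exact/countable_small/countable1.
apply/seteqP; split=> // x _.
suff H y : span gens y -> exists b, span (gens_below b) y.
  by have [b bx] := H _ (set_mem (valP x)); exists b.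
move: y; apply: span_min => [|y z [b bx] [e ez]|y [b _ by_]].
(* Bounding the empty set shows that [L] is inhabited. *)
- have [a _] := small_bounded hL (countable_small hL (@countable0 L)).
  by exists a; apply: span0.
- exists (Order.max b e); apply: spanB.
    by apply: span_mono bx; apply: gens_below_le; rewrite le_max lexx.
  by apply: span_mono ez; apply: gens_below_le; rewrite le_max lexx orbT.
- by have [e be] := above b; exists e; apply: span_sub; exists b.
Qed.

Lemma card_group_le : [set: group] #<= [set: L].
Proof.
exact: (card_le_bigcup_small hL (F := filt) filt_small filt_le filt_cover).
Qed.

Lemma filt_filtration : filtration filt.
Proof.
split.
- exact: filt_zmod_closed.
- by move=> a b [_ /ltW ab _]; apply: filt_le.
- move=> a; rewrite /card_lt filt_small andbT.
  exact: card_le_trans (card_leT _) card_group_le.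
- exact: filt_limit.
- exact: filt_cover.
Qed.

End Construction.

Theorem theorem2p1 (disp : Order.disp_t) (L : orderType disp) (p : nat)
    (S : set L) (c A : L -> set L)
    (hL : regular_uncountable_cardinal L)
    (hp : prime p)
    (hC : club_guessing S c)
    (hA : forall d, S d -> A d `<=` c d /\ order_type_omega (A d)) :
  exists (G : zmodType) (Gs : L -> set G),
    [/\ separable_pgroup p G,
        [set: G] #= [set: L],
        filtration Gs
      & forall d, S d -> inv_sets Gs c d (A d)].
Proof.
have /choice[f hf] : forall d, exists g : nat -> L, S d ->
    {mono g : m n / (m <= n)%N >-> (m <= n)%O} /\ range g = A d.
  move=> d; have [/hA[_ [g gm gA]]|nS] := pselect (S d); first by exists g.
  (* Off [S] the implication is vacuous, so a constant sequence is a valid default. *)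
  by exists (fun=> d).
exists (group p f), (@filt _ _ p f); split.
- exact: group_separable.
- by rewrite card_eq_le card_group_le ?card_le_group.
- exact: filt_filtration.
move=> d Sd; have [fmono fA] := hf d Sd; have [Ac _] := hA d Sd.
have [_ cd _ _] := hC; have [woL _ _ _] := hL.
have fc n : c d (f d n) by apply: Ac; rewrite -fA; exists n.
exists (@witness _ _ p f d) => //; rewrite -fA.
by apply: inv_setP => // n; apply: cd Sd _ (fc n).
Qed.
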